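(* Let $G=(V,E)$ be an $n$-node DAG, let $p$ demand pairs arrive online (each with the target reachable from the source in $G$), and in each round generate a path for the current pair and add its edges to the current preserver $H$ (initially empty). Then the final preserver satisfies $$|E(H)|\le O\left((np|S|)^{1/2}+n\right)$$ in either of the following settings: (i) $P\subseteq S\times V$ and every path is generated by \texttt{backwards-growth}; (ii) $P\subseteq V\times S$ and every path is generated by \texttt{forwards-growth}. Here $P$ is the set of demand pairs and $S\subseteq V$.
   Context: \texttt{forwards-growth}$(G,H,(s,t))$: start with $\pi=(s)$; while the last node $u$ of $\pi$ is not $t$: if there is an edge $(u,v)\in E(H)$ with $t$ reachable from $v$ in $G$, append any such $v$; otherwise append any $v$ with $(u,v)\in E(G)$ and $t$ reachable from $v$. \texttt{backwards-growth}$(G,H,(s,t))$: start with $\pi=(t)$; while the first node $v$ of $\pi$ is not $s$: if there is $(u,v)\in E(H)$ with $u$ reachable from $s$, prepend any such $u$; otherwise prepend any $u$ with $(u,v)\in E(G)$ and $u$ reachable from $s$. Choices among admissible edges are arbitrary; the bound holds for all such choices. *)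

(* Defs.v *)
From mathcomp Require Import all_boot.

Set Implicit Arguments.
Unset Strict Implicit.
Unset Printing Implicit Defensive.

Section Preservers.

Variable V : finType.

(* A digraph on V is given by its edge set; the edge (u, v) points from u
   to v. *)
Implicit Types (G H : {set V * V}) (st : V * V) (u v s t : V) (pi : seq V).

Definition edge_rel G : rel V := fun u v => (u, v) \in G.

Definition reaches G u v : bool := connect (edge_rel G) u v.

(* [::] is the only closed walk; length-one cycles are loops, so these are
   excluded too. *)
Definition acyclic G : Prop :=
  forall c : seq V, cycle (edge_rel G) c -> c = [::].

Definition path_edges pi : {set V * V} := [set e in zip pi (behead pi)].

Definition forwards_choice G H t u v : bool :=
  if [exists w, ((u, w) \in H) && reaches G w t]
  then ((u, v) \in H) && reaches G v t
  else ((u, v) \in G) && reaches G v t.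

Definition backwards_choice G H s v u : bool :=
  if [exists w, ((w, v) \in H) && reaches G s w]
  then ((u, v) \in H) && reaches G s u
  else ((u, v) \in G) && reaches G s u.

(* [forwards_loop G H t pi out]: some sequence of admissible choices makes the
   while loop, entered with current node sequence pi, exit with out. *)
Inductive forwards_loop G H t : seq V -> seq V -> Prop :=
| ForwardsExit pi :
    forwards_loop G H t (rcons pi t) (rcons pi t)
| ForwardsAppend pi u v out :
    u != t -> forwards_choice G H t u v ->
    forwards_loop G H t (rcons (rcons pi u) v) out ->
    forwards_loop G H t (rcons pi u) out.

Inductive backwards_loop G H s : seq V -> seq V -> Prop :=
| BackwardsExit pi :
    backwards_loop G H s (s :: pi) (s :: pi)
| BackwardsPrepend pi u v out :
    v != s -> backwards_choice G H s v u ->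
    backwards_loop G H s (u :: v :: pi) out ->
    backwards_loop G H s (v :: pi) out.

Definition forwards_growth G H st out : Prop :=
  forwards_loop G H st.2 [:: st.1] out.

Definition backwards_growth G H st out : Prop :=
  backwards_loop G H st.1 [:: st.2] out.

(* [online_preserver gen D H]: H is a possible final preserver after the
   demand pairs in D have arrived in this order, where [gen H' st pi] means
   that pi may be generated for the pair st when the preserver is H'. *)
Inductive online_preserver (gen : {set V * V} -> V * V -> seq V -> Prop) :
  seq (V * V) -> {set V * V} -> Prop :=
| OnlineStart : online_preserver gen [::] set0
| OnlineRound D H st pi :
    online_preserver gen D H -> gen H st pi ->
    online_preserver gen (rcons D st) (H :|: path_edges pi).

End Preservers.

(* Main.v *)
(** Give every edge of the final preserver the round that created it and the
    target of that round.  Under forwards growth, an edge [(u, v)] created for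
    target [t] at a time when [(u, w)] is already present certifies that [w]
    does not reach [t].  Send a pair of edges leaving the same node, created in
    rounds [i < j], to [(i, t_j)].  This is injective: if the path of round [i]
    visited [u] and then [u'], and rounds with the same target [t] later
    branched off at both, then the edge chosen at [u] in round [i] led to [u']
    and hence to [t], so no new edge for [t] was needed at [u].  Hence the
    out-degrees satisfy [sum d(u)^2 <= 2 p |S| + |H|], and Cauchy-Schwarz gives
    the bound.  Backwards growth is forwards growth in the converse graph. *)

Require Import Defs.
From HB Require Import structures.
From mathcomp Require Import all_boot all_order all_algebra.
From mathcomp Require Import reals.
From mathcomp Require Import lra.

Set Implicit Arguments.
Unset Strict Implicit.
Unset Printing Implicit Defensive.

Import Order.TTheory GRing.Theory Num.Theory.

(** * Edges of a node sequence grown at either end *)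

Section PathEdges.

Variable V : finType.
Implicit Types (x y u v : V) (pi : seq V).

Lemma path_edges_seq1 x : path_edges [:: x] = set0.
Proof. by apply/setP=> e; rewrite !inE. Qed.

Lemma path_edges_cons x y pi :
  path_edges [:: x, y & pi] = (x, y) |: path_edges (y :: pi).
Proof. by apply/setP=> e; rewrite !inE. Qed.

Lemma path_edges_rcons pi u v :
  path_edges (rcons (rcons pi u) v) = (u, v) |: path_edges (rcons pi u).
Proof.
elim: pi => [|x [|y pi] IH] /=; first by rewrite path_edges_cons.
  by rewrite !path_edges_cons setUCA.
by rewrite !path_edges_cons /= in IH *; rewrite IH setUCA.
Qed.

End PathEdges.

(** * Forwards growth: labelling the edges and charging the branchings *)

Section ForwardsGrowth.

Variables (V : finType) (G : {set V * V}).
Hypothesis acycG : acyclic G.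
Implicit Types (H : {set V * V}) (e f : V * V) (t : V).

Lemma acyclic_not_reaches e : e \in G -> ~~ reaches G e.2 e.1.
Proof.
case: e => u v uvG; apply/negP => /connectP[c pc /= eu].
by have := @acycG (v :: c); rewrite /= rcons_path pc -eu => /(_ uvG).
Qed.

Lemma reaches_edge e t : e \in G -> reaches G e.2 t -> reaches G e.1 t.
Proof. by case: e => u v uvG; apply/connect_trans/connect1. Qed.

(** Expresses by reachability alone that the edges can be ordered along a walk, so that no positions
    need be tracked. *)
Definition sequential (E : {set V * V}) : Prop :=
  {in E &, forall e f, e != f -> reaches G e.2 f.1 || reaches G f.2 e.1}.

(** An edge outside [H] is appended only when the search for a usable edge of [H] fails at its tail;
    the last clause records this failure. *)
Lemma forwards_growth_edges H st pi :
  H \subset G -> forwards_growth G H st pi ->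
  [/\ path_edges pi \subset G, sequential (path_edges pi) &
      {in path_edges pi :\: H, forall e, reaches G e.2 st.2 /\
         forall f, f \in H -> f.1 = e.1 -> ~~ reaches G f.2 st.2}].
Proof.
move=> sHG; set t := st.2.
pose ok (E : {set V * V}) := [/\ E \subset G, sequential E &
  {in E :\: H, forall e, reaches G e.2 t /\
     forall f, f \in H -> f.1 = e.1 -> ~~ reaches G f.2 t}].
(* Loop invariant: the head of every edge so far reaches the current last node, so an appended edge
   comes after all earlier ones. *)
suff loopP q out : forwards_loop G H t q out ->
    (forall q' u, q = rcons q' u ->
       {in path_edges q, forall e, reaches G e.2 u}) ->
    ok (path_edges q) -> ok (path_edges out).
  move=> /loopP; rewrite path_edges_seq1; apply; first by move=> ? ? _ e; rewrite inE.
  by split=> [|e f|e]; rewrite ?sub0set ?setD0 ?set0D ?inE.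
elim=> // q' u v out' _ uv _ IH toend [sG sq new]; apply: IH.
  move=> q1 w /rcons_inj[_ <-] e; rewrite path_edges_rcons !inE.
  case/predU1P=> [->|eq']; first exact: connect0.
  apply: connect_trans (toend _ _ erefl _ _) (connect1 _); first by rewrite inE.
  rewrite /edge_rel; move: uv; rewrite /forwards_choice.
  by case: ifP => _ /andP[] // /(subsetP sHG).
have uvG : (u, v) \in G.
  move: uv; rewrite /forwards_choice.
  by case: ifP => _ /andP[] // /(subsetP sHG).
rewrite path_edges_rcons; split.
- by rewrite subUset sub1set uvG.
- move=> e f /setU1P[->|eq'] /setU1P[->|fq'] //=; rewrite ?eqxx //.
  + by rewrite (toend _ _ erefl _ fq') orbT.
  + by rewrite (toend _ _ erefl _ eq').
  + exact: sq.
- move=> e /setDP[/setU1P[->|eq'] eH]; last by apply: new; rewrite inE eH.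
  move: uv; rewrite /forwards_choice; case: ifP => [_|/negbT noH].
    by rewrite (negPf eH).
  case/andP=> _ vt; split=> // -[w z] fH /= wu; apply: contraNN noH => zt.
  by apply/existsP; exists z; rewrite -wu fH.
Qed.

(** [lab] is the round that created an edge and [tgt] the target of that round. The third clause is
    the certificate left by the later of two edges at a node; the fourth says that each round added
    edges of a single walk. *)
Definition labelled (S : {set V}) p H (lab : V * V -> nat) (tgt : V * V -> V) :=
  [/\ H \subset G,
      {in H, forall e, [/\ lab e < p, tgt e \in S & reaches G e.2 (tgt e)]},
      {in H &, forall e f, e.1 = f.1 -> lab e < lab f -> ~~ reaches G e.2 (tgt f)}
    & {in H &, forall e f, lab e = lab f -> e != f ->
         reaches G e.2 f.1 || reaches G f.2 e.1}].

Lemma online_forwards_labelled (S : {set V}) D H :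
  online_preserver (forwards_growth G) D H ->
  {in D, forall st, st.2 \in S} ->
  exists lab tgt, labelled S (size D) H lab tgt.
Proof.
elim=> [|{}D {}H st pi _ IH gen] DS.
  by exists (fun=> 0), snd; split=> [|e|e f|e f]; rewrite ?sub0set ?inE.
have DS' : {in D, forall st', st'.2 \in S}.
  by move=> x xD; apply: DS; rewrite mem_rcons inE xD orbT.
have [lab [tgt [sHG bnd ord seq]]] := IH DS'.
have stS : st.2 \in S by apply: DS; rewrite mem_rcons inE eqxx.
have [sG sq new] := forwards_growth_edges sHG gen.
have inN e : e \in H :|: path_edges pi -> e \notin H -> e \in path_edges pi :\: H.
  by move=> + eH; rewrite in_setU in_setD (negPf eH).
(* The fresh label [size D] exceeds all old ones. So with one old and one new edge, either the
   certificate of the new edge applies or the assumption on labels fails. *)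
exists (fun e => if e \in H then lab e else size D).
exists (fun e => if e \in H then tgt e else st.2).
split.
- by rewrite subUset sHG.
- move=> e eU; case: ifPn => eH; rewrite size_rcons.
    by have [? ? ?] := bnd e eH; split=> //; apply: ltnW.
  by have [? _] := new e (inN _ eU eH).
- move=> e f eU fU ef; case: ifPn => eH; case: ifPn => fH.
  + exact: ord.
  + by move=> _; have [_] := new f (inN _ fU fH); apply.
  + by have [fD _ _] := bnd f fH; rewrite ltnNge (ltnW fD).
  + by rewrite ltnn.
- move=> e f eU fU; case: ifPn => eH; case: ifPn => fH.
  + exact: seq.
  + by have [eD _ _] := bnd e eH => eqD; rewrite eqD ltnn in eD.
  + by have [fD _ _] := bnd f fH => eqD; rewrite -eqD ltnn in fD.
  + have /setDP[ep _] := inN e eU eH; have /setDP[fp _] := inN f fU fH.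
    by move=> _; apply: sq.
Qed.

Lemma labelled_branching S p H lab tgt : labelled S p H lab tgt ->
  #|[set x in setX H H | (x.1.1 == x.2.1) && (lab x.1 < lab x.2)]| <= p * #|S|.
Proof.
case=> sHG bnd ord seq; set B := [set x in _ | _].
(* Two distinct edges of one round leaving the same node would close a cycle. *)
have uniq_src e f : e \in H -> f \in H -> e.1 = f.1 -> lab e = lab f -> e = f.
  move=> eH fH ef lef; apply/eqP/negPn/negP => /(seq e f eH fH lef).
  have := acyclic_not_reaches (subsetP sHG e eH).
  have := acyclic_not_reaches (subsetP sHG f fH).
  by rewrite -ef => /negPf -> /negPf ->.
case: (posnP p) => [p0|p_gt0].
  rewrite p0 mul0n leqn0 cards_eq0 -subset0; apply/subsetP => x.
  by rewrite !inE => /andP[/andP[/bnd[]]]; rewrite p0.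
(* The default [Ordinal p_gt0] is never taken on [B], as labels on [H] are below [p]. *)
pose chg (x : (V * V) * (V * V)) := (insubd (Ordinal p_gt0) (lab x.1), tgt x.2).
have <- : #|setX [set: 'I_p] S| = p * #|S| by rewrite cardsX cardsT card_ord.
rewrite -(card_in_imset (f := chg)); last first.
  move=> [e e'] [f f']; rewrite !inE /=.
  move=> /andP[/andP[eH e'H] /andP[/eqP ee' lee']].
  move=> /andP[/andP[fH f'H] /andP[/eqP ff' lff']] [] /(congr1 val).
  have [ep _ _] := bnd e eH; have [fp _ _] := bnd f fH.
  rewrite !val_insubd ep fp => lef tef.
  have [_ _ e't] := bnd e' e'H; have [_ _ f't] := bnd f' f'H.
  (* If [e] preceded [f] in their common round, [e] would lead to the source of [f'] and on to the
     target shared by [e'] and [f'], against the certificate of [e']. The other order is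
     symmetric. *)
  have ef : e = f.
    apply/eqP/negPn/negP => /(seq e f eH fH lef)/orP[r|r].
      have := ord e e' eH e'H ee' lee'; rewrite tef; apply/negP/negPn.
      apply: connect_trans r _; rewrite ff'.
      exact: reaches_edge (subsetP sHG _ f'H) f't.
    have := ord f f' fH f'H ff' lff'; rewrite -tef; apply/negP/negPn.
    apply: connect_trans r _; rewrite ee'.
    exact: reaches_edge (subsetP sHG _ e'H) e't.
  rewrite -ef in ff' *; congr pair.
  (* Now [e'] and [f'] share source and target. The earlier one would reach that target, against the
     certificate of the later one; so their rounds agree. *)
  have e'f' : e'.1 = f'.1 by rewrite -ee'.
  apply: uniq_src => //; case: (ltngtP (lab e') (lab f')) => // l.
    by have := ord e' f' e'H f'H e'f' l; rewrite -tef e't.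
  by have := ord f' e' f'H e'H (esym e'f') l; rewrite tef f't.
apply/subset_leq_card/subsetP => _ /imsetP[x xB ->].
by move: xB; rewrite !inE => /andP[/andP[_ /bnd[]]].
Qed.

(** Comparing labels splits the pairs into increasing ones, their swaps and, by acyclicity, the
    diagonal. *)
Lemma labelled_same_source S p H lab tgt : labelled S p H lab tgt ->
  #|[set x in setX H H | x.1.1 == x.2.1]| <= 2 * (p * #|S|) + #|H|.
Proof.
move=> L; have := labelled_branching L; set B := [set x in _ | _] => leB.
pose sw (x : (V * V) * (V * V)) := (x.2, x.1).
apply: leq_trans (_ : #|(B :|: sw @: B) :|: [set (e, e) | e in H]| <= _).
  apply/subset_leq_card/subsetP => -[e f].
  rewrite !inE /= => /andP[/andP[eH fH] /eqP ef]; rewrite eH fH ef eqxx /=.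
  case: (ltngtP (lab e) (lab f)) => //= l.
    by apply/orP; left; apply/imsetP; exists (f, e); rewrite // !inE eH fH ef eqxx.
  apply/orP; right; apply/imsetP; exists e => //; congr pair; apply/esym/eqP.
  case: L => sHG _ _ seq; apply/negPn/negP => /(seq e f eH fH l).
  have := acyclic_not_reaches (subsetP sHG e eH).
  have := acyclic_not_reaches (subsetP sHG f fH).
  by rewrite -ef => /negPf -> /negPf ->.
apply: leq_trans (leq_card_setU _ _) _; apply: leq_add; last exact: leq_imset_card.
apply: leq_trans (leq_card_setU _ _) _; rewrite mul2n -addnn leq_add //.
exact: leq_trans (leq_imset_card _ _) leB.
Qed.

End ForwardsGrowth.

(** * Cauchy-Schwarz for out-degrees *)

Lemma sum_sqr_leq (I : finType) (d : I -> nat) :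
  (\sum_i d i) ^ 2 <= #|I| * \sum_i d i ^ 2.
Proof.
(* Doubling allows the termwise bound [2 * (d i * d j) <= d i ^ 2 + d j ^ 2]. *)
rewrite -(leq_pmul2l (m := 2)) // -mulnn big_distrlr /= big_distrr /=.
under eq_bigr do rewrite big_distrr /=.
apply: leq_trans (_ : \sum_i \sum_j (d i ^ 2 + d j ^ 2) <= _).
  by apply: leq_sum => i _; apply: leq_sum => j _; apply: nat_Cauchy.
under eq_bigr do rewrite big_split /= sum_nat_const.
by rewrite big_split /= sum_nat_const -big_distrr /= mul2n addnn.
Qed.

(** The out-degrees sum to [#|H|], and their squares sum to the number of ordered pairs of edges
    with a common source. *)
Lemma card_edges_sqr_leq (V : finType) (H : {set V * V}) :
  #|H| ^ 2 <= #|V| * #|[set x in setX H H | x.1.1 == x.2.1]|.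
Proof.
pose d u := #|[set e in H | e.1 == u]|.
have -> : #|H| = \sum_u d u.
  rewrite -sum1_card (partition_big fst predT) //=.
  by apply: eq_bigr => u _; rewrite /d -sum1_card; apply: eq_bigl => e; rewrite inE.
have -> : #|[set x in setX H H | x.1.1 == x.2.1]| = \sum_u d u ^ 2.
  rewrite -sum1_card (partition_big (fun x => x.1.1) predT) //=.
  apply: eq_bigr => u _; rewrite -mulnn -cardsX -sum1_card.
  apply: eq_bigl => -[e f]; rewrite !inE /=.
  by case: (e.1 =P u) => [->|]; rewrite ?andbF //= !andbT eq_sym -andbA.
exact: sum_sqr_leq.
Qed.

Lemma online_forwards_card (V : finType) (G : {set V * V}) (S : {set V}) D H :
  acyclic G -> {in D, forall st, st.2 \in S} ->
  online_preserver (forwards_growth G) D H ->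
  #|H| ^ 2 <= #|V| * (2 * (size D * #|S|) + #|H|).
Proof.
move=> acycG DS /online_forwards_labelled/(_ DS)[lab [tgt /labelled_same_source]].
move=> /(_ acycG) le; apply: leq_trans (card_edges_sqr_leq H) _.
by rewrite leq_mul2l le orbT.
Qed.

(** * Reversing all edges turns backwards growth into forwards growth *)

Section Converse.

Variable V : finType.
Implicit Types (G H : {set V * V}) (e : V * V) (pi : seq V).

Definition swap e := (e.2, e.1).

Lemma swapK : involutive swap. Proof. by case. Qed.

Definition converse H := swap @^-1: H.

Lemma in_converse H u v : ((u, v) \in converse H) = ((v, u) \in H).
Proof. by rewrite inE. Qed.

Lemma card_converse H : #|converse H| = #|H|.
Proof. by apply/on_card_preimset/onW_bij/inv_bij/swapK. Qed.

Lemma reaches_converse G u v : reaches (converse G) u v = reaches G v u.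
Proof.
rewrite /reaches [RHS]connect_rev; apply: eq_connect => x y.
by rewrite /edge_rel in_converse.
Qed.

Lemma acyclic_converse G : acyclic G -> acyclic (converse G).
Proof.
move=> acycG c cc; rewrite -[c]revK (acycG (rev c)) //.
rewrite rev_cycle; apply: etrans cc; apply: eq_cycle => x y.
by rewrite /edge_rel in_converse.
Qed.

Lemma path_edges_rev pi : path_edges (rev pi) = converse (path_edges pi).
Proof.
elim: pi => [|x [|y pi] IH]; try by apply/setP=> e; rewrite !inE.
rewrite !rev_cons in IH *; rewrite path_edges_rcons IH path_edges_cons.
by apply/setP=> -[u v]; rewrite !inE /= !xpair_eqE andbC.
Qed.

Lemma backwards_choice_converse G H s v u :
  backwards_choice G H s v u = forwards_choice (converse G) (converse H) s v u.
Proof.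
rewrite /backwards_choice /forwards_choice !in_converse !reaches_converse.
by under [in RHS]eq_existsb do rewrite in_converse reaches_converse.
Qed.

(** Prepending to a walk is appending to its reversal, and the source becomes the target. *)
Lemma backwards_growth_converse G H st pi : backwards_growth G H st pi ->
  forwards_growth (converse G) (converse H) (swap st) (rev pi).
Proof.
suff loop q out : backwards_loop G H st.1 q out ->
    forwards_loop (converse G) (converse H) st.1 (rev q) (rev out) by apply: loop.
elim=> [{}q|{}q u v {}out vs uv _ IH].
  by rewrite rev_cons; apply: ForwardsExit.
rewrite rev_cons; apply: ForwardsAppend vs _ _; last by rewrite !rev_cons in IH; exact: IH.
by rewrite -backwards_choice_converse.
Qed.

Lemma online_backwards_converse G D H :
  online_preserver (backwards_growth G) D H ->
  online_preserver (forwards_growth (converse G)) (map swap D) (converse H).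
Proof.
elim=> [|{}D {}H st pi _ IH gen]; first by rewrite /converse preimset0; constructor.
rewrite map_rcons [converse (_ :|: _)]preimsetU.
rewrite -[swap @^-1: path_edges pi]/(converse _) -path_edges_rev.
by constructor=> //; apply: backwards_growth_converse.
Qed.

End Converse.

(** * From the quadratic inequality to the square-root bound *)

Local Open Scope ring_scope.

Lemma sqr_leq_sqrt_bound (R : rcfType) (m n q : nat) :
  (m ^ 2 <= n * (2 * q + m))%N ->
  m%:R <= 2 * (Num.sqrt (n * q)%:R + n%:R) :> R.
Proof.
rewrite -(ler_nat R) !(natrX, natrM, natrD) => le.
set x := Num.sqrt _.
have x0 : 0 <= x by apply: sqrtr_ge0.
have x2 : x ^+ 2 = n%:R * q%:R by rewrite sqr_sqrtr // mulr_ge0.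
have n0 : 0 <= n%:R :> R by [].
have m0 : 0 <= m%:R :> R by [].
(* With [m > 2 * (x + n)], [m ^ 2] exceeds [2 * x * m + 2 * n * m], which is at least
   [4 * x ^ 2 + 2 * n * m]; but [le] bounds it by [2 * x ^ 2 + n * m]. *)
rewrite leNgt; apply/negP => lt; nra.
Qed.

Theorem theorem12 (R : realType) :
  exists C : R, 0 < C /\
    forall (n p : nat) (V : finType) (G : {set V * V}) (S : {set V})
      (D : p.-tuple (V * V)) (H : {set V * V}),
      #|V| = n ->
      acyclic G ->
      (forall st : V * V, st \in D -> reaches G st.1 st.2) ->
      ([set st in D] \subset setX S [set: V] /\
         online_preserver (backwards_growth G) D H
       \/
       [set st in D] \subset setX [set: V] S /\
         online_preserver (forwards_growth G) D H) ->
      #|H|%:R <= C * (Num.sqrt (n * p * #|S|)%:R + n%:R).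
Proof.
exists 2; split=> // n p V G S D H Vn acycG _ online.
rewrite -mulnA; apply: sqr_leq_sqrt_bound; rewrite -Vn -(size_tuple D).
case: online => -[/subsetP DS online].
  rewrite -card_converse -(size_map (@swap V)).
  apply: online_forwards_card (acyclic_converse acycG) _
    (online_backwards_converse online).
  by move=> _ /mapP[st stD ->]; have := DS st; rewrite !inE => /(_ stD)/andP[].
apply: online_forwards_card acycG _ online.
by move=> st stD; have := DS st; rewrite !inE => /(_ stD).
Qed.
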